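(* Let $k$ be a field, and let $f=(f_1,\ldots,f_n)\colon\mathbb{A}^n_k\to\mathbb{A}^n_k$ be a polynomial morphism with finite fibers. If the Bézoutian $\mathrm{B\acute ez}(f)$ is constant (i.e. $\mathrm{B\acute ez}(f)\in k$), then $f$ is injective on $k$-rational points.
   Context: Write $\mathbf{x}=(x_1,\ldots,x_n)$, $\mathbf{y}=(y_1,\ldots,y_n)$. A polynomial morphism $f\colon\mathbb{A}^n_k\to\mathbb{A}^n_k$ is given by polynomials $f_1,\ldots,f_n\in k[\mathbf{x}]$. The (multivariate) Bézoutian of $f$ is the determinant $\mathrm{B\acute ez}(f):=\det(\Delta_{ij})\in k[\mathbf{x},\mathbf{y}]$, where $$\Delta_{ij}=\frac{f_i(y_1,\ldots,y_{j-1},x_j,\ldots,x_n)-f_i(y_1,\ldots,y_j,x_{j+1},\ldots,x_n)}{x_j-y_j}.$$ ''Finite fibers'' means that the set-theoretic fiber of $f$ over every point is finite. ''Injective on $k$-rational points'' means that the induced map $\mathbb{A}^n_k(k)=k^n\to k^n$ is injective. *)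

(* Defs.v *)
From HB Require Import structures.
From mathcomp Require Import all_boot all_order all_algebra.
From mathcomp Require Import mpoly.
From mathcomp Require Import boolp classical_sets cardinality.

Set Implicit Arguments.
Unset Strict Implicit.
Unset Printing Implicit Defensive.

Import GRing.Theory.
Local Open Scope ring_scope.
Local Open Scope classical_set_scope.

Section PolynomialMorphism.
Variables (k : fieldType) (n : nat).

(* The points of the scheme A^n_k = Spec k[x_1, ..., x_n] (not only the closed
   or the rational ones), as prime ideals.  [idealr_closed] includes 1 \notin p. *)
Definition affine_points : set (set {mpoly k[n]}) :=
  [set p | idealr_closed (mem p) /\ prime_idealr_closed (mem p)].

(* A morphism A^n_k -> A^n_k is given by the tuple f of its components; it sends
   the prime p to the contraction of p along g |-> g(f_1, ..., f_n). *)
Definition morphism_on_points (f : n.-tuple {mpoly k[n]})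
    (p : set {mpoly k[n]}) : set {mpoly k[n]} :=
  [set g | p (g \mPo f)].

Definition fiber (f : n.-tuple {mpoly k[n]}) (q : set {mpoly k[n]}) :
    set (set {mpoly k[n]}) :=
  affine_points `&` [set p | morphism_on_points f p = q].

Definition finite_fibers (f : n.-tuple {mpoly k[n]}) : Prop :=
  forall q, affine_points q -> finite_set (fiber f q).

Definition rational_map (f : n.-tuple {mpoly k[n]}) (a : n.-tuple k) :
    n.-tuple k :=
  [tuple (tnth f i).@[tnth a] | i < n].

End PolynomialMorphism.

Section Bezoutian.
Variables (k : fieldType) (n : nat).

(* k[x, y] is k[X_0, ..., X_(2n-1)]: the first n variables are the x_j, the last
   n are the y_j. *)
Definition varx (j : 'I_n) : {mpoly k[n + n]} := 'X_(lshift n j).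
Definition vary (j : 'I_n) : {mpoly k[n + n]} := 'X_(rshift n j).

(* (y_1, ..., y_m, x_(m+1), ..., x_n) *)
Definition hybrid (m : nat) : n.-tuple {mpoly k[n + n]} :=
  [tuple (if (i < m)%N then vary i else varx i) | i < n].

(* Indices start at 0, so the j-th column uses hybrid j and hybrid j.+1. *)
Definition delta_num (f : n.-tuple {mpoly k[n]}) (i j : 'I_n) :
    {mpoly k[n + n]} :=
  (tnth f i \mPo hybrid j) - (tnth f i \mPo hybrid j.+1).

Lemma comp_mpoly_cong (d : {mpoly k[n + n]}) (u v : n.-tuple {mpoly k[n + n]}) :
  (forall i, exists r, r * d = tnth u i - tnth v i) ->
  forall p : {mpoly k[n]}, exists r, r * d = (p \mPo u) - (p \mPo v).
Proof.
move=> uv; have cM a a' b b' : (exists r, r * d = a - a') ->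
    (exists r, r * d = b - b') -> exists r, r * d = a * b - a' * b'.
  move=> [r er] [s es]; exists (r * b + a' * s).
  by rewrite mulrDl -mulrA [b * d]mulrC mulrA er -mulrA es mulrBl mulrBr addrA subrK.
elim/mpolyind=> [|c m p _ _ [r er]].
  by exists 0; rewrite !comp_mpoly0 subrr mul0r.
suff [s es] : exists s, s * d = ('X_[m] \mPo u) - ('X_[m] \mPo v).
  exists (c *: s + r); rewrite mulrDl -scalerAl es er !comp_mpolyD !comp_mpolyZ.
  by rewrite scalerBr opprD addrACA.
rewrite !comp_mpolyX; apply: (big_ind2 (fun a b => exists r, r * d = a - b)).
- by exists 0; rewrite subrr mul0r.
- by move=> a a' b b'; apply: cM.
move=> i _; elim: (m i) => [|e IH]; first by exists 0; rewrite !expr0 subrr mul0r.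
by rewrite !exprS; apply: cM.
Qed.

Lemma delta_exists (f : n.-tuple {mpoly k[n]}) (i j : 'I_n) :
  exists r, r * (varx j - vary j) == delta_num f i j.
Proof.
suff [r er] : exists r, r * (varx j - vary j) = delta_num f i j.
  by exists r; rewrite er.
apply: comp_mpoly_cong => l; rewrite !tnth_mktuple ltnS.
case: (ltngtP l j) => [_|_|/val_inj->].
- by exists 0; rewrite subrr mul0r.
- by exists 0; rewrite subrr mul0r.
by exists 1; rewrite mul1r.
Qed.

(* The exact quotient of delta_num f i j by x_j - y_j; it is unique, since
   k[x, y] is a domain and x_j - y_j is nonzero. *)
Definition delta (f : n.-tuple {mpoly k[n]}) (i j : 'I_n) : {mpoly k[n + n]} :=
  xchoose (delta_exists f i j).

Lemma deltaE (f : n.-tuple {mpoly k[n]}) (i j : 'I_n) :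
  delta f i j * (varx j - vary j) = delta_num f i j.
Proof. exact/eqP/(xchooseP (delta_exists f i j)). Qed.

Lemma varx_subr_vary_neq0 (j : 'I_n) : varx j - vary j != 0.
Proof.
rewrite subr_eq0; apply/eqP => /(congr1 (mcoeff U_(lshift n j))).
rewrite !mcoeffX eqxx; case: eqP => [/mnmP/(_ (lshift n j))|_ /eqP].
  by rewrite !mnmE eqxx eq_rlshift.
by rewrite oner_eq0.
Qed.

Lemma delta_unique (f : n.-tuple {mpoly k[n]}) (i j : 'I_n) r :
  r * (varx j - vary j) = delta_num f i j -> r = delta f i j.
Proof. by rewrite -deltaE; apply: mulIf; apply: varx_subr_vary_neq0. Qed.

Definition bezoutian (f : n.-tuple {mpoly k[n]}) : {mpoly k[n + n]} :=
  \det (\matrix_(i < n, j < n) delta f i j).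

End Bezoutian.

(* Main.v *)
Require Import Defs.
From HB Require Import structures.
From mathcomp Require Import all_boot all_order all_algebra.
From mathcomp Require Import mpoly.
From mathcomp Require Import boolp classical_sets cardinality.

Import GRing.Theory.
Local Open Scope ring_scope.

Set Implicit Arguments.
Unset Strict Implicit.
Unset Printing Implicit Defensive.

(* Fix a in k^n, and let D be the matrix Delta(x, a), so that D (x - a) = f(x) - f(a)
   and det D = Bez(f)(x, a) = c. If f(b) = f(a) with b <> a, then D(b) kills b - a,
   hence c = 0. It remains to see that det D <> 0.

   The ideal I = (f_i - f_i(a)) lies in finitely many primes. If it contained no
   nonzero polynomial in x_i alone, some prime p above I would avoid k[x_i] \ 0.
   Extend x_i to a maximal subset x_B of the variables that is algebraically
   independent modulo p: after inverting some s in k[x_B], A/p is a finite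
   extension of k[x_B], and infinitely many primes lie over p, a contradiction.
   So I contains some u_i(x_i) <> 0 for each i. Writing these as H (f - f(a)) gives
   (H D) (x - a) = (u_i(x_i))_i, and such a matrix has nonzero determinant: the
   determinant does not even belong to the ideal of the u_i(x_i). *)

(** * Ideals, and primes avoiding a multiplicative set *)

Section Ideals.
Variable R : comNzRingType.
Implicit Types (I S : set R) (u v a : R).

(* Unlike [idealr_closed], this allows the unit ideal. *)
Definition is_ideal I := I 0 /\ forall a u v, I u -> I v -> I (a * u + v).

Definition is_prime I :=
  [/\ is_ideal I, ~ I 1 & forall u v, I (u * v) -> I u \/ I v].

Lemma idealM I a u : is_ideal I -> I u -> I (a * u).
Proof. by case=> I0 IE Iu; rewrite -[_ * _]addr0; apply: IE. Qed.

Lemma idealD I u v : is_ideal I -> I u -> I v -> I (u + v).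
Proof. by case=> I0 IE Iu Iv; rewrite -[u]mul1r; apply: IE. Qed.

Lemma idealN I u : is_ideal I -> I u -> I (- u).
Proof. by move=> II Iu; rewrite -mulN1r; apply: idealM. Qed.

Lemma idealB I u v : is_ideal I -> I u -> I v -> I (u - v).
Proof. by move=> II Iu Iv; apply: idealD => //; apply: idealN. Qed.

Lemma ideal_sum I (T : Type) (r : seq T) (P : pred T) (F : T -> R) :
  is_ideal I -> (forall i, P i -> I (F i)) -> I (\sum_(i <- r | P i) F i).
Proof.
move=> II IF; apply: (big_ind I) => //; first by case: II.
by move=> u v; apply: idealD.
Qed.

Definition gen_ideal m (w : 'I_m -> R) : set R :=
  [set g | exists h : 'I_m -> R, g = \sum_j h j * w j].

Lemma gen_ideal_ideal m (w : 'I_m -> R) : is_ideal (gen_ideal w).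
Proof.
split; first by exists (fun=> 0); rewrite big1 // => j _; rewrite mul0r.
move=> a u v [h ->] [h' ->]; exists (fun j => a * h j + h' j).
by rewrite mulr_sumr -big_split; apply: eq_bigr => j _; rewrite mulrDl mulrA.
Qed.

Lemma mem_gen_ideal m (w : 'I_m -> R) j : gen_ideal w (w j).
Proof.
exists (fun l => (l == j)%:R); rewrite (bigD1 j) //= eqxx mul1r big1 ?addr0 //.
by move=> l /negPf->; rewrite mul0r.
Qed.

Lemma gen_ideal_sub m (w : 'I_m -> R) I :
  is_ideal I -> (forall j, I (w j)) -> (gen_ideal w `<=` I)%classic.
Proof. by move=> II Iw g [h ->]; apply: ideal_sum => // j _; apply: idealM. Qed.

Definition addp I a : set R := [set g | exists2 u, I u & exists b, g = u + b * a].

Lemma addp_ideal I a : is_ideal I -> is_ideal (addp I a).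
Proof.
move=> II; split; first by exists 0; [case: II|exists 0; rewrite mul0r addr0].
move=> c _ _ [u Iu [b ->]] [v Iv [b' ->]]; exists (c * u + v).
  by apply: (proj2 II).
by exists (c * b + b'); rewrite mulrDr mulrDl !mulrA addrACA.
Qed.

Lemma addpl I a u : I u -> addp I a u.
Proof. by move=> Iu; exists u => //; exists 0; rewrite mul0r addr0. Qed.

Lemma addpr I a : is_ideal I -> addp I a a.
Proof. by case=> I0 _; exists 0 => //; exists 1; rewrite mul1r add0r. Qed.

(** By Zorn's lemma, some ideal is maximal among those containing [I] and disjoint from [S];
    maximality makes it prime. *)
Lemma exists_prime_avoiding I S :
    is_ideal I -> S 1 -> (forall u v, S u -> S v -> S (u * v)) ->
    (forall u, I u -> ~ S u) ->
  exists p, [/\ is_prime p, (I `<=` p)%classic & forall u, p u -> ~ S u].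
Proof.
move=> II S1 SM IS.
pose P (X : set R) := X = set0 \/
  [/\ is_ideal X, (I `<=` X)%classic & forall u, X u -> ~ S u].
have [F FP Ftot|p [Pp pmax]] := Zorn_bigcup (P := P).
  have [[X FX X0]|F0] := pselect (exists2 X, F X & X <> set0); last first.
    left; apply/seteqP; split=> // u [X FX Xu]; apply: F0; exists X => // X0.
    by rewrite X0 in Xu.
  right; have [//|[XI IX XS]] := FP _ FX; split.
  - split; first by exists X => //; case: XI.
    move=> a u v [Y FY Yu] [Z FZ Zv].
    have [YZ|ZY] := Ftot _ _ FY FZ.
      have [Z0|[[_ ZE] _ _]] := FP _ FZ; first by rewrite Z0 in Zv.
      by exists Z => //; apply: ZE => //; apply: YZ.
    have [Y0|[[_ YE] _ _]] := FP _ FY; first by rewrite Y0 in Yu.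
    by exists Y => //; apply: YE => //; apply: ZY.
  - by move=> u Iu; exists X => //; apply: IX.
  - move=> u [Y FY Yu]; have [Y0|[_ _]] := FP _ FY; first by rewrite Y0 in Yu.
    exact.
have I0 : I 0 by case: II.
have [p0|[pI Ip pS]] := Pp.
  have: P I by right; split.
  move/pmax; case; rewrite p0; split=> //.
  by move=> /(_ 0 I0).
have max a : ~ p a -> exists2 s, S s & addp p a s.
  move=> npa; apply: contrapT => nS.
  have /pmax[] : (p `<` addp p a)%classic.
    split; last by move=> /(_ a (addpr a pI)).
    by move=> u; apply: addpl.
  right; split; first exact: addp_ideal.
  - by move=> u /Ip; apply: addpl.
  - by move=> u pu Su; apply: nS; exists u.
exists p; split=> //; split=> //.
  by move=> /pS.
move=> u v puv; apply: contrapT => /not_orP[/max[s Ss [x px [b es]]]].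
move=> /max[t St [y py [c et]]].
apply: (pS (s * t)); last exact: SM.
(* Here s = x + b u and t = y + c v with x, y in p, so u v in p would put s t in p. *)
have -> : s * t = (y + c * v) * x + ((b * u) * y + (b * c) * (u * v)).
  by rewrite es et mulrDl [x * _]mulrC [b * u * (_ + _)]mulrDr [b * u * (_ * _)]mulrACA.
by apply: idealD => //; [apply: idealM|apply: idealD => //; apply: idealM].
Qed.

End Ideals.

(** * Determinants and cofactors *)

Section LinearAlgebra.
Variables (R : comNzRingType) (n : nat).

(** Coordinate [i] of adj(N) N z = det(N) z. A relation N z = w thus puts det(N) z_i in the ideal of
    the w_j. *)
Lemma det_mulr_cofactor (N : 'M[R]_n) (z : 'I_n -> R) i :
  \det N * z i = \sum_j (\sum_l N j l * z l) * cofactor N j i.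
Proof.
have /matrixP/(_ i 0) : \adj N *m (N *m \col_l z l) = \det N *: \col_l z l.
  by rewrite mulmxA mul_adj_mx mul_scalar_mx.
rewrite [RHS]mxE [X in _ = _ * X]mxE => <-; rewrite mxE.
apply: eq_bigr => j _; rewrite !mxE mulrC; congr (_ * _).
by apply: eq_bigr => l _; rewrite mxE.
Qed.

Lemma cofactor_id_row (N N' : 'M[R]_n) (i : 'I_n) :
    (forall j l, j != i -> N' j l = N j l) ->
    (forall l, N' i l = (i == l)%:R) ->
  cofactor N i i = \det N'.
Proof.
move=> eN iN; rewrite (expand_det_row N' i) (bigD1 i) //= iN eqxx mul1r.
rewrite big1 => [|l il]; last by rewrite iN eq_sym (negPf il) mul0r.
rewrite addr0 /cofactor; congr (_ * \det _); apply/matrixP => j l.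
by rewrite !mxE eN // eq_sym neq_lift.
Qed.
End LinearAlgebra.

(** * Polynomials in a single variable x_i, and cancellation modulo ideals *)

(** Descending induction on e: coefficient e + deg u of u q is lead(u) q_e plus multiples of later
    coefficients of q, and lead(u) is invertible in k. *)
Lemma poly_coef_cancel (k : fieldType) (R : comAlgType k) (K : set R)
    (u : {poly k}) (q : {poly R}) :
    is_ideal K -> u != 0 ->
    (forall e, K (map_poly (in_alg R) u * q)`_e) ->
  forall e, K q`_e.
Proof.
move=> KI u0 Kuq e.
have [N] := ubnP (size q - e); elim: N e => // N IH e leN.
have [le_qe|lt_eq] := leqP (size q) e.
  by rewrite nth_default //; case: KI.
have Kgt e' : (e < e')%N -> K q`_e'.
  move=> ee'; apply: IH; apply: leq_trans (ltn_sub2l _ _) _; last exact: leN.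
    exact: lt_eq.
  exact: ee'.
have := Kuq (e + (size u).-1)%N; rewrite coefM.
have lt_d : ((size u).-1 < (e + (size u).-1).+1)%N by rewrite ltnS leq_addl.
rewrite (bigD1 (Ordinal lt_d)) //= coef_map /= addnK -lead_coefE => Ksum.
have {Ksum} Klead : K ((lead_coef u)%:A * q`_e).
  rewrite -[_ * _](addrK (\sum_(i < (e + (size u).-1).+1 | i != Ordinal lt_d)
    (map_poly (in_alg R) u)`_i * q`_(e + (size u).-1 - i))).
  apply: idealB => //; apply: ideal_sum => // s.
  rewrite -val_eqE /= coef_map /= neq_ltn => /orP[lt_s|gt_s].
    apply: idealM => //; apply: Kgt.
    by rewrite ltn_subRL addnC ltn_add2l.
  rewrite nth_default ?scale0r ?mul0r; first by case: KI.
  by move: gt_s; rewrite prednK // lt0n size_poly_eq0.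
rewrite -[q`_e]scale1r -(mulVf (_ : lead_coef u != 0)) ?lead_coef_eq0 //.
by rewrite -scalerA -mulr_algl; apply: idealM => //; rewrite -mulr_algl.
Qed.

Section PolynomialRing.
Variables (k : fieldType) (n : nat).
Local Notation A := {mpoly k[n]}.

Lemma mpoly_rmorph_ext (S : nzRingType) (F G : {rmorphism A -> S}) :
    (forall c, F c%:MP = G c%:MP) -> (forall i, F 'X_i = G 'X_i) -> F =1 G.
Proof.
move=> eC eX p; rewrite [p]mpolyE !rmorph_sum; apply: eq_bigr => m _.
rewrite -mul_mpolyC !rmorphM eC mpolyXE_id !rmorph_prod; congr (_ * _).
by apply: eq_bigr => i _; rewrite !rmorphXn /= eX.
Qed.

Definition univ (i : 'I_n) : {poly k} -> A := horner_alg 'X_i.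
HB.instance Definition _ i := GRing.RMorphism.on (univ i).

(** A is viewed as a polynomial ring in x_i. The coefficients, although free of x_i, are kept in A,
    so that evaluation at x_i gives back the polynomial. *)
Definition as_poly (i : 'I_n) : A -> {poly A} :=
  mmap (polyC \o @mpolyC n k) (fun l => if l == i then 'X else ('X_l)%:P).
HB.instance Definition _ i := GRing.RMorphism.on (as_poly i).

Lemma as_polyC i c : as_poly i c%:MP = c%:MP%:P.
Proof. by rewrite /as_poly mmapC. Qed.

Lemma as_polyX i l : as_poly i 'X_l = if l == i then 'X else ('X_l)%:P.
Proof. by rewrite /as_poly mmapX mmap1U. Qed.

Lemma as_polyK i p : (as_poly i p).['X_i] = p.
Proof.
rewrite -horner_evalE.
pose F := GRing.RMorphism.clone _ _ (horner_eval 'X_i \o as_poly i) _.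
apply: (mpoly_rmorph_ext (F := F) (G := idfun)) => [c|l] /=.
  by rewrite as_polyC horner_evalE hornerC.
by rewrite as_polyX horner_evalE; case: eqP => [->|_]; rewrite ?hornerX ?hornerC.
Qed.

Lemma as_poly_univ i u : as_poly i (univ i u) = map_poly (in_alg A) u.
Proof.
elim/poly_ind: u => [|u c IH]; first by rewrite !rmorph0.
rewrite !rmorphD !rmorphM /= IH /univ horner_algX as_polyX eqxx map_polyX.
by rewrite horner_algC map_polyC /= -mul_mpolyC mulr1 as_polyC.
Qed.

Lemma as_poly_univ_neq i j u : j != i -> as_poly i (univ j u) = (univ j u)%:P.
Proof.
move=> ji; elim/poly_ind: u => [|u c IH]; first by rewrite !rmorph0.
rewrite !rmorphD !rmorphM /= IH /univ horner_algX as_polyX (negPf ji).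
by rewrite horner_algC -mul_mpolyC mulr1 as_polyC.
Qed.

(** The second hypothesis says that the generators are free of x_i. Hence membership in the ideal
    passes to the coefficients in x_i, where [poly_coef_cancel] removes u. *)
Lemma gen_ideal_univ_cancel m (w : 'I_m -> A) i u g :
    u != 0 -> (forall j, as_poly i (w j) = (w j)%:P) ->
  gen_ideal w (univ i u * g) -> gen_ideal w g.
Proof.
move=> u0 ew [h eh]; rewrite -(as_polyK i g) horner_coef.
apply: ideal_sum => [|e _]; first exact: gen_ideal_ideal.
rewrite mulrC; apply: idealM; first exact: gen_ideal_ideal.
apply: poly_coef_cancel (gen_ideal_ideal w) u0 _ _ => e'.
exists (fun j => (as_poly i (h j))`_e').
rewrite -(as_poly_univ i) -rmorphM eh.
rewrite rmorph_sum coef_sum; apply: eq_bigr => j _.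
by rewrite rmorphM /= ew coefMC.
Qed.

(* Let P_j = u_j(x_j) and z_j = x_j - a_j. By descending induction on m, the
   determinant of M with rows i >= m replaced by those of the identity is not in
   (P_j : j < m) + (z_j : j >= m). *)
Lemma det_univ_neq0 (a : 'I_n -> k) (u : 'I_n -> {poly k}) (M : 'M[A]_n) :
    (forall j, u j != 0) ->
    (forall i, \sum_j M i j * ('X_j - (a j)%:MP) = univ i (u i)) ->
  \det M != 0.
Proof.
move=> u0 eM; pose z j : A := 'X_j - (a j)%:MP.
pose w m (j : 'I_n) := if (j < m)%N then univ j (u j) else z j.
pose D m := \matrix_(i < n, j < n) if (i < m)%N then M i j else (i == j)%:R.
have zE j : z j = univ j ('X - (a j)%:P).
  by rewrite rmorphB /= /univ horner_algX horner_algC -mul_mpolyC mulr1.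
suff H m : (m <= n)%N -> ~ gen_ideal (w m) (\det (D m)).
  apply/eqP => M0; apply: (H n) => //.
  have -> : D n = M by apply/matrixP => i j; rewrite mxE ltn_ord.
  by rewrite M0; case: (gen_ideal_ideal (w n)).
elim: m => [_|m IH lt_mn].
  have -> : D 0 = 1%:M by apply/matrixP => i j; rewrite !mxE.
  (* Evaluation at a kills every z_j but not 1. *)
  rewrite det1 => -[h /(congr1 (meval a))]; rewrite meval1 rmorph_sum /=.
  rewrite big1 => [/eqP|j _]; first by rewrite oner_eq0.
  by rewrite mevalM mevalB mevalXU mevalC subrr mulr0.
(* [J] drops the generator of index i, the only one involving x_i. *)
pose i := Ordinal lt_mn; pose J j := if j == i then 0 else w m j.
have JI := gen_ideal_ideal J.
have wJ j : j != i -> gen_ideal J (w m j).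
  by move=> ji; have := mem_gen_ideal J j; rewrite /J (negPf ji).
have ltS (j : 'I_n) : j != i -> (j < m.+1)%N = (j < m)%N.
  by rewrite -val_eqE ltnS leq_eqVlt => /negPf->.
have wS j : j != i -> w m.+1 j = w m j by move=> ji; rewrite /w ltS.
have wi : w m.+1 i = univ i (u i) by rewrite /w /= ltnSn.
have wmi : w m i = z i by rewrite /w /= ltnn.
move=> [h eD]; apply: (IH (ltnW lt_mn)).
have Dz j : \sum_l D m.+1 j l * z l = w m.+1 j.
  rewrite /w; case: ltnP => jm; first by rewrite -eM; apply: eq_bigr => l _; rewrite mxE jm.
  rewrite (bigD1 j) //= mxE ltnNge jm /= eqxx mul1r big1 ?addr0 // => l lj.
  by rewrite mxE ltnNge jm /= eq_sym (negPf lj) mul0r.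
(* Cramer's rule at i gives det(D (m+1)) z_i = u_i(x_i) det(D m) modulo J, while the assumed
   membership gives det(D (m+1)) = h_i u_i(x_i) modulo J. *)
have Jm : gen_ideal J (univ i (u i) * (\det (D m) - h i * z i)).
  have := det_mulr_cofactor (D m.+1) z i.
  rewrite (bigD1 i) //= Dz wi (@cofactor_id_row _ _ _ (D m)); first last.
  - by move=> l; rewrite mxE /= ltnn.
  - by move=> j l ji; rewrite !mxE ltS.
  rewrite eD (bigD1 i) //= wi => /esym/(canRL (addrK _)) e.
  rewrite mulrBr e mulrDl -mulrA [h i * (_ * _)]mulrCA addrAC [_ + _ * z i]addrC addrK.
  apply: idealB => //; last first.
    apply: ideal_sum => // j ji; rewrite mulrC; apply: idealM => //.
    by rewrite Dz wS //; apply: wJ.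
  rewrite mulrC; apply: idealM => //; apply: ideal_sum => // j ji.
  by rewrite wS //; apply: idealM => //; apply: wJ.
have {Jm} Jm : gen_ideal J (\det (D m) - h i * z i).
  apply: gen_ideal_univ_cancel (u0 i) _ Jm => j.
  rewrite /J; case: eqP => [_|/eqP ji]; first by rewrite rmorph0.
  by rewrite /w; case: ifP => _; rewrite ?zE as_poly_univ_neq.
rewrite -[\det _](subrK (h i * z i)) -wmi; apply: idealD; first exact: gen_ideal_ideal.
  rewrite wmi; apply: gen_ideal_sub Jm => [|j]; first exact: gen_ideal_ideal.
  by rewrite /J; case: ifP => _; [case: (gen_ideal_ideal (w m))|apply: mem_gen_ideal].
by apply: idealM; [apply: gen_ideal_ideal|apply: mem_gen_ideal].
Qed.
End PolynomialRing.

(** * Algebraic independence and integrality modulo an ideal *)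

(** The polynomial det(a - X C) takes the value a^m at 0, so X divides its difference with a^m; then
    X is set to h. *)
Lemma det_scalar_sub_scale (R : comNzRingType) m (a h : R) (C : 'M[R]_m) :
  exists c, \det (a%:M - h *: C) = a ^+ m + h * c.
Proof.
pose q : {poly R} := \det (map_mx polyC a%:M - 'X *: map_mx polyC C).
have qE x : q.[x] = \det (a%:M - x *: C).
  rewrite -horner_evalE /q -det_map_mx; congr (\det _); apply/matrixP => i j.
  by rewrite !mxE /= /horner_eval hornerD hornerN hornerM hornerX !hornerC.
have /factor_theorem[r er] : root (q - (a ^+ m)%:P) 0.
  by rewrite rootE hornerD hornerN hornerC qE scale0r subr0 det_scalar subrr.
exists r.[h]; rewrite -qE -[q](subrK (a ^+ m)%:P) er subr0 hornerD hornerM.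
by rewrite hornerX hornerC addrC mulrC.
Qed.

Section Subring.
Variables (k : fieldType) (n : nat).
Local Notation A := {mpoly k[n]}.
Implicit Types (B : {set 'I_n}) (p : set A).

(** A retraction of A onto k[x_B]. As it is a ring morphism, membership in k[x_B] becomes an
    equation between morphisms, to be checked on the variables. *)
Definition kill_outside B : A -> A :=
  comp_mpoly [tuple if l \in B then 'X_l else 0 | l < n].
HB.instance Definition _ B := GRing.RMorphism.on (kill_outside B).

Lemma kill_outsideC B c : kill_outside B c%:MP = c%:MP.
Proof. exact: comp_mpolyC. Qed.

Lemma kill_outsideX B l : kill_outside B 'X_l = if l \in B then 'X_l else 0.
Proof. by rewrite /kill_outside comp_mpolyXU -tnth_nth tnth_mktuple. Qed.

(* k[x_l, l in B], as the set of fixed points of [kill_outside B]. *)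
Definition subvars B : {pred A} := [pred g | kill_outside B g == g].

Fact subvars_subring B : subring_closed (subvars B).
Proof.
split; first by rewrite inE /= rmorph1.
  by move=> u v /eqP eu /eqP ev; rewrite inE /= rmorphB /= eu ev.
by move=> u v /eqP eu /eqP ev; rewrite inE /= rmorphM /= eu ev.
Qed.
HB.instance Definition _ B := GRing.isSubringClosed.Build A (subvars B)
  (subvars_subring B).

Lemma subvarsX B l : l \in B -> 'X_l \in subvars B.
Proof. by move=> lB; rewrite inE /= kill_outsideX lB. Qed.

Lemma det_subvars B m (N : 'M[A]_m) :
  (forall i j, N i j \in subvars B) -> \det N \in subvars B.
Proof.
move=> NB; rewrite inE /= -det_map_mx; apply/eqP; congr (\det _).
by apply/matrixP => i j; rewrite mxE; apply/eqP/NB.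
Qed.

Lemma as_poly_subvars B j g :
  g \in subvars (j |: B) -> j \notin B -> forall e, (as_poly j g)`_e \in subvars B.
Proof.
move=> /eqP eg jB e; rewrite inE /= -coef_map.
suff -> : map_poly (kill_outside B) (as_poly j g) = as_poly j g by [].
rewrite -eg.
pose F := GRing.RMorphism.clone _ _
  (map_poly (kill_outside B) \o as_poly j \o kill_outside (j |: B)) _.
pose G := GRing.RMorphism.clone _ _ (as_poly j \o kill_outside (j |: B)) _.
apply: (mpoly_rmorph_ext (F := F) (G := G)) => [c|l] /=.
  by rewrite kill_outsideC as_polyC map_polyC /= kill_outsideC.
rewrite kill_outsideX in_setU1; case: eqP => [->|/eqP lj] /=.
  by rewrite as_polyX eqxx map_polyX.
case: ifP => lB; last by rewrite !rmorph0.
by rewrite as_polyX (negPf lj) map_polyC /= kill_outsideX lB.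
Qed.

Lemma subvars1 i g : g \in subvars [set i] -> exists u, g = univ i u.
Proof.
move=> /eqP <-.
pose U : A -> {poly k} := mmap polyC (fun l => if l == i then 'X else 0).
exists (U g).
pose F := GRing.RMorphism.clone _ _ (univ i \o U) _.
apply: (mpoly_rmorph_ext (F := kill_outside [set i]) (G := F)) => [c|l] /=.
  by rewrite kill_outsideC /U mmapC /univ horner_algC -mul_mpolyC mulr1.
rewrite kill_outsideX /U mmapX mmap1U inE; case: eqP => [->|_].
  by rewrite /univ horner_algX.
by rewrite rmorph0.
Qed.

(** For an ideal p, this says that k[x_B] embeds into A/p. *)
Definition indep_mod p B := forall g, g \in subvars B -> p g -> g = 0.

(** For s in k[x_B], an integral equation for x_j modulo p once s is inverted. The degree D is
    explicit so that it can be made the same for all variables. *)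
Definition integral_mod p B j (s : A) (D : nat) := exists q : {poly A},
  [/\ (size q <= D)%N, q \is a polyOver (subvars B) & p (s * 'X_j ^+ D - q.['X_j])].

(** The relation is multiplied by t x_j^r. *)
Lemma integral_mod_widen p B j s D t r : is_ideal p -> t \in subvars B ->
  integral_mod p B j s D -> integral_mod p B j (t * s) (r + D).
Proof.
move=> pI tB [q [sq qB pq]]; exists (t%:P * 'X^r * q); split.
- apply: leq_trans (size_polyMleq _ _) _.
  have sr : (size (t%:P * 'X^r : {poly A})%R <= r.+1)%N.
    by rewrite mul_polyC (leq_trans (size_scale_leq _ _)) ?size_polyXn.
  by rewrite -ltnS; case: (_ + _)%N (leq_add sr sq) => // x; rewrite addSn.
- by rewrite !rpredM ?polyOverC ?polyOverXn.
rewrite !hornerM hornerC hornerXn exprD mulrACA -mulrBr; exact: idealM.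
Qed.

Lemma integral_mod_mem p B j : is_ideal p -> j \in B -> integral_mod p B j 1 1.
Proof.
move=> pI jB; exists ('X_j)%:P; split.
- by rewrite size_polyC leq_b1.
- by rewrite polyOverC subvarsX.
- by rewrite hornerC mul1r expr1 subrr; case: pI.
Qed.

(** A nonzero relation in p between x_j and x_B is read as a polynomial in x_j: s is its leading
    coefficient and D its degree. *)
Lemma integral_mod_dep p B j : is_ideal p -> j \notin B ->
    ~ indep_mod p (j |: B) ->
  exists s D, [/\ s != 0, s \in subvars B & integral_mod p B j s D].
Proof.
move=> pI jB nind.
have [g [gB pg /eqP g0]] : exists g, [/\ g \in subvars (j |: B), p g & g <> 0].
  apply: contrapT => H; apply: nind => g gB pg; apply: contrapT => g0.
  by apply: H; exists g.
pose G := as_poly j g; have GB := as_poly_subvars gB jB.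
have G0 : G != 0 by apply: contraNneq g0 => G0; rewrite -(as_polyK j g) -/G G0 horner0.
exists (lead_coef G), (size G).-1; split; first by rewrite lead_coef_eq0.
  exact: GB.
exists (lead_coef G *: 'X^((size G).-1) - G); split.
- apply/leq_sizeP => e; rewrite leq_eqVlt => /orP[/eqP<-|lt_e].
    by rewrite coefB coefZ coefXn eqxx mulr1 subrr.
  rewrite coefB coefZ coefXn gtn_eqF // mulr0 nth_default ?subrr //.
  by move: lt_e; rewrite prednK // lt0n size_poly_eq0.
- apply/polyOverP => e; rewrite coefB coefZ coefXn.
  by rewrite rpredB ?rpredM ?rpred_nat ?GB.
- by rewrite hornerD hornerN hornerZ hornerXn as_polyK opprB addrC subrK.
Qed.

(** The product of the individual s and the sum of the individual degrees serve all variables. The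
    successor makes the common degree positive even if all of these are 0. *)
Lemma integral_mod_maximal p B : is_ideal p ->
    (forall j, j \notin B -> ~ indep_mod p (j |: B)) ->
  exists s D, [/\ s != 0, s \in subvars B & forall j, integral_mod p B j s D.+1].
Proof.
move=> pI Bmax.
have H j : exists sD : A * nat,
    [/\ sD.1 != 0, sD.1 \in subvars B & integral_mod p B j sD.1 sD.2].
  have [jB|jB] := boolP (j \in B).
    exists (1, 1%N); split; [exact: oner_neq0|exact: rpred1|].
    exact: integral_mod_mem.
  have [s [D H]] := integral_mod_dep pI jB (Bmax j jB).
  by exists (s, D).
have {H} [F HF] := choice H.
exists (\prod_j (F j).1), (\sum_j (F j).2)%N; split.
- by apply/prodf_neq0 => j _; case: (HF j).
- by apply: rpred_prod => j _; case: (HF j).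
move=> j; rewrite (bigD1 j) //= (bigD1 (F := fun j => (F j).2) j) //= mulrC.
rewrite addnC -addSn; apply: integral_mod_widen => //; last by case: (HF j).
by apply: rpred_prod => l _; case: (HF l).
Qed.

(* A finite set of generators of the localization of A/p at s over
   k[x_l, l in B]. *)
Lemma integral_mod_generators p B s D : is_ideal p -> s \in subvars B ->
    (forall j, integral_mod p B j s D.+1) ->
  exists m (w : 'I_m -> A), (exists i0, w i0 = 1) /\
    forall g, exists N (c : 'I_m -> A), (forall i, c i \in subvars B) /\
      p (s ^+ N * g - \sum_i c i * w i).
Proof.
move=> pI sB intj; pose E := {ffun 'I_n -> 'I_D.+1}.
pose mono (x : E) : A := \prod_j 'X_j ^+ x j.
(* [W] holds of the elements generated, up to a power of s, by the monomials with all exponents at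
   most D. It is shown to be stable under sums and under multiplication by k[x_B] and by each
   x_j. *)
pose W g := exists N (c : E -> A), (forall x, c x \in subvars B) /\
  p (s ^+ N * g - \sum_x c x * mono x).
have p0 : p 0 by case: pI.
have WD g g' : W g -> W g' -> W (g + g').
  move=> [N [c [cB pc]]] [N' [c' [cB' pc']]]; exists (N + N')%N.
  exists (fun x => s ^+ N' * c x + s ^+ N * c' x); split.
    by move=> x; rewrite rpredD ?rpredM ?rpredX.
  under eq_bigr do rewrite mulrDl -!mulrA.
  rewrite big_split /= -!mulr_sumr.
  have -> : s ^+ (N + N') * (g + g') = s ^+ N' * (s ^+ N * g) + s ^+ N * (s ^+ N' * g').
    by rewrite mulrDr !mulrA -!exprD [(N' + N)%N]addnC.
  by rewrite opprD addrACA -!mulrBr; apply: idealD => //; apply: idealM.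
have WZ a g : a \in subvars B -> W g -> W (a * g).
  move=> aB [N [c [cB pc]]]; exists N, (fun x => a * c x); split.
    by move=> x; rewrite rpredM.
  under eq_bigr do rewrite -mulrA.
  by rewrite -mulr_sumr mulrCA -mulrBr; apply: idealM.
have W0 : W 0.
  exists 0%N, (fun=> 0); split; first by move=> x; exact: rpred0.
  by rewrite mulr0 big1 ?subrr // => x _; rewrite mul0r.
have Wsum (T : finType) (G : T -> A) : (forall x, W (G x)) -> W (\sum_x G x).
  by move=> WG; apply: (big_ind W).
have Wp g : p g -> W g.
  move=> pg; exists 0%N, (fun=> 0); split; first by move=> x; exact: rpred0.
  by rewrite expr0 mul1r big1 ?subr0 // => x _; rewrite mul0r.
have WB g g' : p (g - g') -> W g' -> W g.
  by move=> /Wp pg Wg; rewrite -[g](subrK g'); apply: WD.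
have Ws N g : W (s ^+ N * g) -> W g.
  move=> [N' [c [cB pc]]]; exists (N' + N)%N, c; split=> //.
  by rewrite exprD -mulrA.
have Wmono x : W (mono x).
  exists 0%N, (fun y => (y == x)%:R); split; first by move=> y; rewrite rpred_nat.
  rewrite expr0 mul1r (bigD1 x) //= eqxx mul1r big1 ?addr0 ?subrr // => y /negPf->.
  by rewrite mul0r.
pose upd (x : E) j e : E := [ffun l => if l == j then e else x l].
pose rest (x : E) j : A := \prod_(l | l != j) 'X_l ^+ x l.
have updE x j e : mono (upd x j e) = 'X_j ^+ e * rest x j.
  rewrite /mono (bigD1 j) //= ffunE eqxx; congr (_ * _).
  by apply: eq_bigr => l /negPf lj; rewrite ffunE lj.
have monoE x j : mono x = 'X_j ^+ x j * rest x j by rewrite /mono (bigD1 j).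
have WX j g : W g -> W ('X_j * g).
  move=> [N [c [cB pc]]]; apply: (Ws N).
  apply: (WB _ ('X_j * \sum_x c x * mono x)).
    by rewrite mulrCA -mulrBr; apply: idealM.
  rewrite mulr_sumr; apply: (Wsum) => x; rewrite mulrCA; apply: (WZ) => //.
  rewrite (monoE x j) mulrA -exprS.
  have [lt_x|] := ltnP (x j).+1 D.+1.
    by rewrite -[(x j).+1]/(val (Ordinal lt_x)) -updE; apply: Wmono.
  rewrite ltnS => le_Dx; have -> : x j = D :> nat.
    by apply/eqP; rewrite eqn_leq le_Dx -ltnS ltn_ord.
  (* The exponent of x_j has reached D + 1; one factor s lets q(x_j), of degree at most D, replace
     x_j^(D+1). *)
  have [q [sq qB pq]] := intj j; apply: (Ws 1%N); rewrite expr1.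
  apply: (WB _ (q.['X_j] * rest x j)).
    by rewrite mulrA -mulrBl mulrC; apply: idealM.
  rewrite (horner_coef_wide _ sq) mulr_suml; apply: Wsum => e.
  rewrite -mulrA -updE; apply: WZ; last exact: Wmono.
  exact: (polyOverP qB).
pose x0 : E := [ffun=> ord0].
have m0 : mono x0 = 1 by rewrite /mono big1 // => j _; rewrite ffunE expr0.
have W1 : W 1 by rewrite -m0; apply: Wmono.
have Wall g : W g.
  elim/mpolyind: g => // c m g _ _ Wg; apply: WD => //; rewrite -mul_mpolyC.
  apply: WZ; first by rewrite inE /= kill_outsideC.
  rewrite mpolyXE_id -[\prod_i _]mulr1.
  apply: (big_ind (fun h => forall g', W g' -> W (h * g'))) W1 => //.
  - by move=> g'; rewrite mul1r.
  - by move=> h h' Wh Wh' g' Wg'; rewrite -mulrA; apply/Wh/Wh'.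
  move=> j _ g' Wg'; elim: (m j) => [|e IH]; first by rewrite mul1r.
  by rewrite exprS -mulrA; apply: WX.
exists #|E|, (fun i => mono (enum_val i)); split.
  by exists (enum_rank x0); rewrite enum_rankK.
move=> g; have [N [c [cB pc]]] := Wall g; exists N, (c \o enum_val); split=> //=.
by move: pc; rewrite (reindex _ (onW_bij _ (@enum_val_bij E))).
Qed.

(* Multiplication by d is given, up to powers of s, by a matrix over k[x_l, l in B]
   on the generators; 1 = h d makes det (s^N - h C') vanish modulo p. *)
Lemma nonunit_mod p B s D h d : is_ideal p -> s \in subvars B ->
    h \in subvars B -> indep_mod p B ->
    (forall j, integral_mod p B j s D.+1) -> p (1 - h * d) ->
  exists M c, s ^+ M = h * c.
Proof.
move=> pI sB hB ind intj phd.
have [m [w [[i0 w1] Wg]]] := integral_mod_generators pI sB intj.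
have [F HF] := choice (fun i => Wg (d * w i)).
have {HF} [C HC] := choice HF.
(* A common exponent: N bounds every [F i], so the rows of C can be rescaled to express s^N d
   w_i. *)
pose N := (\sum_i F i)%N.
pose C' := \matrix_(i < m, j < m) (s ^+ (N - F i) * C i j).
have [c ec] := det_scalar_sub_scale (s ^+ N) h C'.
exists (N * m)%N, (- c); apply/eqP; rewrite exprM mulrN -addr_eq0 -ec; apply/eqP.
(* The determinant lies in k[x_B], so it vanishes as soon as it lies in p. *)
apply: ind.
  apply: det_subvars => i j; rewrite !mxE.
  by rewrite rpredB ?rpredMn ?rpredM ?rpredX //; case: (HC i).
rewrite -[\det _]mulr1 -w1 det_mulr_cofactor; apply: ideal_sum => // i _.
rewrite mulrC; apply: idealM => //.
have -> : \sum_l (((s ^+ N)%:M - h *: C') i l) * w l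
    = s ^+ N * (1 - h * d) * w i +
      h * (s ^+ (N - F i) * (s ^+ F i * (d * w i) - \sum_l C i l * w l)).
  under eq_bigr do rewrite !mxE mulrBl -!mulrA.
  rewrite big_split /= sumrN (bigD1 i) //= eqxx mulr1n big1 => [|l /negPf il]; last first.
    by rewrite eq_sym il mul0r.
  have FN : (F i <= N)%N by rewrite /N (bigD1 i) //= leq_addr.
  rewrite -!mulr_sumr addr0 [s ^+ (N - _) * (_ - _)]mulrBr.
  rewrite [s ^+ (N - _) * (s ^+ _ * _)]mulrA -exprD subnK // [h * (_ - _)]mulrBr.
  by rewrite mulrBr mulr1 mulrBl addrA [h * (_ * (d * _))]mulrCA !mulrA subrK.
apply: idealD => //; last by apply: idealM => //; apply: idealM => //; case: (HC i).
by rewrite mulrAC; apply: idealM.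
Qed.
End Subring.

(** * Ideals contained in only finitely many primes *)

Section FinitelyManyPrimes.
Variables (k : fieldType) (n : nat).
Local Notation A := {mpoly k[n]}.

(** G is the product of one nonzero element of P in k[x_B] for each listed P that has one. *)
Lemma common_subvars B (r : seq (set A)) :
  exists G, [/\ G != 0, G \in subvars B & forall P, P \in r -> is_ideal P ->
    (exists g, [/\ g \in subvars B, g != 0 & P g]) -> P G].
Proof.
elim: r => [|P r [G [G0 GB HG]]].
  by exists 1; split; [exact: oner_neq0|exact: rpred1|].
have [[g [gB g0 Pg]]|nP] :=
    pselect (exists g, [/\ g \in subvars B, g != 0 & P g]); last first.
  by exists G; split=> // Q; rewrite inE => /orP[/eqP->|/HG].
exists (g * G); split; [by rewrite mulf_neq0|by rewrite rpredM|].
move=> Q; rewrite inE => /orP[/eqP->|Qr] QI Qg; last first.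
  by apply: idealM => //; apply: HG.
by rewrite mulrC; apply: idealM.
Qed.

(** 1 = (1 - (t s)^M) + t^M s^M: h divides the first term by the geometric sum, the second by
    hypothesis. *)
Lemma one_sub_dvd_exp (R : comNzRingType) (h t s c : R) M :
  h = 1 - t * s -> s ^+ M = h * c -> exists y, h * y = 1.
Proof.
move=> eh es; exists (\sum_(e < M) (t * s) ^+ e + t ^+ M * c).
rewrite mulrDr mulrCA -es -exprMn {1}eh -[1 - _]opprB mulNr -subrX1 opprB.
exact: subrK.
Qed.

(** Units of A are constants, and by degrees x_i g is constant only for g = 0. *)
Lemma one_add_var_unit (i : 'I_n) (g y : A) : (1 + 'X_i * g) * y = 1 -> g = 0.
Proof.
rewrite mulrC => /mpoly_intro_unit /andP[/eqP eC _]; apply/eqP.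
apply: contraTT isT => g0.
have e : 'X_i * g = ((1 + 'X_i * g)@_0 - 1)%:MP.
  by rewrite mpolyCB mpolyC1 -eC addrC addKr.
have X0 : 'X_i != 0 :> A by rewrite -msize_poly_eq0 msizeX.
have := msizeM X0 g0; rewrite e msizeX mdeg1 msizeC => eM.
have : (0 < msize g)%N by rewrite lt0n msize_poly_eq0.
by move: eM; case: (msize g) => // z; case: (_ != _).
Qed.

(** Infinitude of primes over p is proved as in Euclid's argument: from a finite list, a new prime
    is found containing 1 plus a multiple of an element common to the relevant listed primes. *)
Lemma univ_mem_of_finite_primes (I : set A) (i : 'I_n) : is_ideal I ->
    finite_set [set p | is_prime p /\ (I `<=` p)%classic]%classic ->
  exists2 u, u != 0 & I (univ i u).
Proof.
move=> II /finite_seqP[r er]; apply: contrapT => nI.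
pose S : set A := [set g | exists2 u, u != 0 & g = univ i u]%classic.
have [|||p [p_prime Ip pS]] := @exists_prime_avoiding _ I S II.
- by exists 1; [exact: oner_neq0|rewrite rmorph1].
- move=> _ _ [u u0 ->] [v v0 ->]; exists (u * v); first by rewrite mulf_neq0.
  by rewrite rmorphM.
- by move=> g Ig [u u0 eu]; apply: nI; exists u; rewrite // -eu.
have [pI p1 _] := p_prime.
have ind_i : `[< indep_mod p [set i] >].
  apply/asboolP => g /subvars1[u ->] pu; apply: contrapT => /eqP gu0.
  apply: (pS _ pu); exists u => //; apply: contraNneq gu0 => ->.
  by rewrite rmorph0.
have [B /maxsetP[/asboolP indB maxB] /fintype.subsetP/(_ i (finset.set11 i)) iB] :=
  maxset_exists (P := fun B => `[< indep_mod p B >]) ind_i.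
have [|s [D [s0 sB ints]]] := integral_mod_maximal (B := B) pI.
  move=> j jB indj; have := maxB (j |: B)%SET.
  move=> /(_ (introT (asboolP _) indj) (finset.subsetUr _ _)) eB.
  by move: jB; rewrite -eB in_setU1 eqxx.
have [G [G0 GB HG]] := common_subvars B r.
(* h is coprime to s, hence not invertible in A/p; but a prime containing p and h
   meets k[x_B], hence contains G. *)
pose h := 1 + 'X_i * (s * G).
have hB : h \in subvars B.
  by rewrite rpredD ?rpred1 // rpredM ?subvarsX // rpredM.
(* The factor x_i keeps h from being a unit even when s and G are constants; h stays in k[x_B]
   because B contains i. *)
have hU y : h * y <> 1.
  by move=> /one_add_var_unit/eqP; rewrite mulf_eq0 (negPf s0) (negPf G0).
have h0 : h != 0.
  apply/eqP => /(congr1 (meval (fun=> 0))) /eqP.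
  by rewrite mevalD mevalM meval1 mevalXU mul0r addr0 meval0 oner_eq0.
have phI := addp_ideal h pI.
have [|||P [P_prime phP _]] := @exists_prime_avoiding _ (addp p h) [set 1]%classic phI.
- by [].
- by move=> u v -> ->; rewrite mulr1.
(* If 1 = u + b h with u in p, then h divides a power of s in A itself; being 1 modulo s, it would
   be a unit. *)
- move=> v [u pu [b eu]] v1; rewrite {}v1 in eu.
  have [|M [c es]] := nonunit_mod (d := b) pI sB hB indB ints.
    by rewrite {1}eu [b * h]mulrC addrK.
  have [|y /hU//] := one_sub_dvd_exp (t := - ('X_i * G)) _ es.
  by rewrite mulNr opprK /h [s * G]mulrC mulrA.
have [PI P1 _] := P_prime.
have Ph : P h by apply/phP/addpr.
apply: P1; rewrite -(addrK ('X_i * (s * G)) 1); apply: idealB => //.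
rewrite mulrA; apply: idealM => //; apply: HG => //; last by exists h.
suff : [set p | is_prime p /\ (I `<=` p)%classic]%classic P by rewrite er.
by split=> // g /Ip pg; apply/phP/addpl.
Qed.
End FinitelyManyPrimes.

(** * The fiber of f over f(a) *)

Section Fiber.
Variables (k : fieldType) (n : nat) (f : n.-tuple {mpoly k[n]}).
Variable a : n.-tuple k.
Local Notation A := {mpoly k[n]}.

Lemma is_primeP (p : set A) : affine_points p <-> is_prime p.
Proof.
have E x : x \in mem p <-> p x by rewrite -[p x]in_setE.
split=> [[[p0 p1 pE] pM]|[[p0 pE] p1 pM]].
  split; first split; first by apply/E.
  - by move=> c u v /E pu /E pv; apply/E/pE.
  - by move=> /E; apply/negP.
  - by move=> u v /E /pM /orP[] /E; [left|right].
split; first split; first by apply/E.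
- by apply/negP => /E.
- by move=> c u v /E pu /E pv; apply/E/pE.
by move=> u v /E /pM[] /E puv; apply/orP; [left|right].
Qed.

Definition fiber_ideal : set A :=
  gen_ideal (fun j => tnth f j - ((tnth f j).@[tnth a])%:MP).

(** Modulo the ideal each f_j is the constant f_j(a), and this propagates from the variables to g
    through sums and products. *)
Lemma comp_mpoly_fiber_ideal g :
  fiber_ideal ((g \mPo f) - (g.@[tnth (rational_map f a)])%:MP).
Proof.
have FI := gen_ideal_ideal (fun j => tnth f j - ((tnth f j).@[tnth a])%:MP).
pose E g := fiber_ideal ((g \mPo f) - (g.@[tnth (rational_map f a)])%:MP).
have EMul g1 g2 : E g1 -> E g2 -> E (g1 * g2).
  rewrite /E => E1 E2; rewrite rmorphM mevalM mpolyCM /=.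
  set x1 := g1 \mPo f in E1 *; set x2 := g2 \mPo f in E2 *.
  set y1 := _%:MP in E1 *; set y2 := _%:MP in E2 *.
  have -> : x1 * x2 - y1 * y2 = x2 * (x1 - y1) + y1 * (x2 - y2).
    by rewrite !mulrBr addrA [x2 * y1]mulrC subrK mulrC.
  by apply: idealD => //; apply: idealM.
have E0 c : E c%:MP by rewrite /E comp_mpolyC mevalC subrr; case: FI.
rewrite -/(E g); elim/mpolyind: g => [|c m g _ _ Eg].
  by rewrite -mpolyC0.
rewrite /E rmorphD mevalD mpolyCD opprD addrACA /=; apply: idealD => //.
rewrite -/(E (c *: 'X_[m])) -mul_mpolyC; apply: (EMul) => //.
rewrite mpolyXE_id; apply: (big_ind E); [by rewrite -mpolyC1|exact: (EMul)|].
move=> j _; elim: (m j) => [|e IH]; first by rewrite expr0 -mpolyC1.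
rewrite exprS; apply: (EMul) => //.
rewrite /E comp_mpolyXU -tnth_nth mevalXU tnth_mktuple; exact: mem_gen_ideal.
Qed.

(** A prime p above the ideal contracts to the maximal ideal [Q] of f(a): modulo p, g(f) is the
    constant g(f(a)), a unit unless it is zero. *)
Lemma prime_fiber_ideal : finite_fibers f ->
  finite_set [set p | is_prime p /\ (fiber_ideal `<=` p)%classic]%classic.
Proof.
pose Q : set A := [set g | g.@[tnth (rational_map f a)] = 0]%classic.
move=> /(_ Q) H; apply: sub_finite_set (H _).
  move=> p [pP Fp]; split; first exact/is_primeP.
  have [pI p1 _] := pP.
  apply/seteqP; split=> g; rewrite /morphism_on_points /Q /=.
    move=> pg; apply: contrapT => /eqP g0; apply: p1.
    set c := g.@[_] in g0.
    rewrite -mpolyC1 -(mulVf g0) mpolyCM; apply: idealM => //.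
    rewrite -[c%:MP](subKr (g \mPo f)); apply: idealB => //.
    exact/Fp/comp_mpoly_fiber_ideal.
  by move=> g0; have /Fp := comp_mpoly_fiber_ideal g; rewrite g0 mpolyC0 subr0.
apply/is_primeP; split; first split.
- exact: meval0.
- by move=> c u v; rewrite /Q /= mevalD mevalM => -> ->; rewrite mulr0 addr0.
- by rewrite /Q /= meval1; apply/eqP/oner_neq0.
move=> u v /eqP; rewrite mevalM mulf_eq0 => /orP[]/eqP; [left|right]; done.
Qed.
End Fiber.

(** * The Bézoutian matrix at y = a, and injectivity *)

Section SpecializedBezoutian.
Variables (k : fieldType) (n : nat) (f : n.-tuple {mpoly k[n]}).
Variable a : n.-tuple k.
Local Notation A := {mpoly k[n]}.

(** Column j contributes the difference of two consecutive hybrids, from [hybrid 0] = x to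
    [hybrid n] = y. *)
Lemma delta_telescope i :
  \sum_j delta f i j * (varx k j - vary k j) =
    (tnth f i \mPo [tuple varx k j | j < n]) -
    (tnth f i \mPo [tuple vary k j | j < n]).
Proof.
have -> : [tuple varx k j | j < n] = hybrid k n 0 by apply: eq_mktuple.
have -> : [tuple vary k j | j < n] = hybrid k n n.
  by apply: eq_mktuple => j; rewrite ltn_ord.
pose F m := tnth f i \mPo hybrid k n m.
under eq_bigr do rewrite deltaE /delta_num -opprB.
rewrite sumrN -[in RHS]opprB; congr (- _).
by rewrite -(telescope_sumr F (leq0n n)) big_mkord.
Qed.

Definition specialize_y : {mpoly k[n + n]} -> A := comp_mpoly
  [tuple match split l with inl j => 'X_j | inr j => (tnth a j)%:MP end | l < n + n].
HB.instance Definition _ := GRing.RMorphism.on specialize_y.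

Lemma specialize_y_varx j : specialize_y (varx k j) = 'X_j.
Proof.
rewrite /specialize_y comp_mpolyXU -tnth_nth tnth_mktuple.
by rewrite -[lshift n j]/(unsplit (inl j)) unsplitK.
Qed.

Lemma specialize_y_vary j : specialize_y (vary k j) = (tnth a j)%:MP.
Proof.
rewrite /specialize_y comp_mpolyXU -tnth_nth tnth_mktuple.
by rewrite -[rshift n j]/(unsplit (inr j)) unsplitK.
Qed.

Definition delta_at : 'M[A]_n := \matrix_(i, j) specialize_y (delta f i j).

Lemma det_delta_at : \det delta_at = specialize_y (bezoutian f).
Proof.
rewrite -det_map_mx; congr (\det _); apply/matrixP => i j.
by rewrite !mxE.
Qed.

Lemma delta_at_sum i : \sum_j delta_at i j * ('X_j - (tnth a j)%:MP) =
  tnth f i - ((tnth f i).@[tnth a])%:MP.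
Proof.
transitivity (specialize_y (\sum_j delta f i j * (varx k j - vary k j))).
  rewrite rmorph_sum; apply: eq_bigr => j _.
  by rewrite rmorphM rmorphB /= specialize_y_varx specialize_y_vary mxE.
rewrite delta_telescope rmorphB /=; congr (_ - _).
  pose F := GRing.RMorphism.clone _ _
    (specialize_y \o comp_mpoly [tuple varx k j | j < n]) _.
  apply: (mpoly_rmorph_ext (F := F) (G := idfun)) => [c|j] /=.
    by rewrite comp_mpolyC /specialize_y comp_mpolyC.
  by rewrite comp_mpolyXU -tnth_nth tnth_mktuple specialize_y_varx.
pose F := GRing.RMorphism.clone _ _
  (specialize_y \o comp_mpoly [tuple vary k j | j < n]) _.
pose G := GRing.RMorphism.clone _ _ (@mpolyC n k \o meval (tnth a)) _.
apply: (mpoly_rmorph_ext (F := F) (G := G)) => [c|j] /=.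
  by rewrite comp_mpolyC /specialize_y comp_mpolyC mevalC.
by rewrite comp_mpolyXU -tnth_nth tnth_mktuple specialize_y_vary mevalXU.
Qed.

Lemma det_delta_at_neq0 : finite_fibers f -> \det delta_at != 0.
Proof.
move=> /(prime_fiber_ideal a) fin.
have /choice[u Hu] i : exists u, u != 0 /\ fiber_ideal f a (univ i u).
  have [|u u0 Fu] := univ_mem_of_finite_primes i _ fin; last by exists u.
  exact: gen_ideal_ideal.
have /choice[h Hh] i := proj2 (Hu i).
(* The product maps x - a to the vector of the u_i(x_i), the situation of [det_univ_neq0]. *)
have : \det ((\matrix_(i, j) h i j) *m delta_at) != 0.
  apply: (det_univ_neq0 (a := tnth a) (u := u)) => [j|i]; first by case: (Hu j).
  under eq_bigr do rewrite mxE mulr_suml.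
  rewrite exchange_big Hh /=; apply: eq_bigr => l _.
  by rewrite -delta_at_sum mulr_sumr; apply: eq_bigr => j _; rewrite mxE mulrA.
by rewrite det_mulmx mulf_eq0 => /norP[].
Qed.

End SpecializedBezoutian.

Theorem corollary1p4 (k : fieldType) (n : nat) (f : n.-tuple {mpoly k[n]}) :
  finite_fibers f ->
  (exists c : k, bezoutian f = c%:MP) ->
  injective (rational_map f).
Proof.
move=> ff [c ec] a b fab; apply: eq_from_tnth => j.
have det_c : \det (delta_at f a) = c%:MP.
  by rewrite det_delta_at ec /specialize_y comp_mpolyC.
have c0 : c != 0.
  by have := det_delta_at_neq0 a ff; rewrite det_c mpolyC_eq0.
(* Cramer's rule evaluated at x = b: c (b_j - a_j) is a combination of the f_i(b) - f_i(a), all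
   zero. *)
have := congr1 (meval (tnth b))
  (det_mulr_cofactor (delta_at f a) (fun l => 'X_l - (tnth a l)%:MP) j).
rewrite det_c mevalM mevalB mevalC mevalXU mevalC rmorph_sum big1 => [|i _].
  by move=> /eqP; rewrite mulf_eq0 (negPf c0) subr_eq0 => /eqP.
rewrite /= delta_at_sum mevalM mevalB mevalC.
have := congr1 (fun t => tnth t i) fab; rewrite !tnth_mktuple => ->.
by rewrite subrr mul0r.
Qed.
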